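(* Let $S$ be a commutative unital ring, $\sigma\in\mathrm{Aut}(S)$ of finite order $m$, $S_0=\{s\in S:\sigma(s)=s\}$, and $a,b\in S^\times$. Suppose $\tau\in\mathrm{Aut}(S)$ commutes with $\sigma$ and $\alpha\in S$ is cancellable (not a zero divisor). Then for any integers $2\le k<n$, the map $G=G_{\tau,\alpha,k}:\mathbb{S}_{t^n-a}\to\mathbb{S}_{t^n-b}$ is a homomorphism of rings if and only if all of the following hold: (1) $k\equiv 1\pmod m$; (2) $m\mid n$; (3) $a,b\in S_0$; (4) $\left(N_{S/S_0}(\alpha)\right)^{n/m}b^k=\tau(a)$. It is an isomorphism if and only if, in addition, (5) $\gcd(k,n)=1$ and $\alpha\in S^\times$.
   Context: Rings $S$ are commutative, associative, with $1\ne 0$. $S[t;\sigma]$ is the skew polynomial ring with $tc=\sigma(c)t$ for $c\in S$. For a monic $f\in S[t;\sigma]$ of degree $n$, every $g\in S[t;\sigma]$ can be written uniquely as $g=qf+r$ with $\deg r<n$; write $r=g \bmod_r f$. The Petit ring $\mathbb{S}_f$ is the additive group of skew polynomials of degree $<n$ with multiplication $g\circ h=gh \bmod_r f$; it is a unital, in general nonassociative, ring containing $S$ as the constants. $N_{S/S_0}(\alpha)=\prod_{j=0}^{m-1}\sigma^j(\alpha)$. ''$G_{\tau,\alpha,k}:\mathbb{S}_f\to\mathbb{S}_h$ is a homomorphism'' means there is a ring homomorphism $G:\mathbb{S}_f\to\mathbb{S}_h$ with $G|_S=\tau$ and $G(t)=\alpha t^k$, i.e. $G(\sum_{i=0}^{n-1}a_it^i)=\sum_{i=0}^{n-1}\tau(a_i)(\alpha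 t^k)^i$ (in particular the powers $(\alpha t^k)^i$, $0\leq i<n$, in $\mathbb{S}_h$ are well-defined, independent of parenthesization). *)

(* Defs.v *)
From HB Require Import structures.
From mathcomp Require Import all_boot all_order all_algebra zify.

Set Implicit Arguments.
Unset Strict Implicit.
Unset Printing Implicit Defensive.

Import GRing.Theory.
Local Open Scope ring_scope.

Definition has_order (T : Type) (sigma : T -> T) (m : nat) : Prop :=
  [/\ (0 < m)%N, iter m sigma =1 id &
      forall j : nat, (0 < j < m)%N -> ~ (iter j sigma =1 id)].

(* The norm N_{S/S_0} of S over the fixed ring S_0 of sigma, m being the order
   of sigma. *)
Definition cyclic_norm (S : comNzRingType) (sigma : S -> S) (m : nat) (x : S) :
  S := \prod_(j < m) iter j sigma x.

(* The skew polynomial ring S[t; sigma], with t * c = sigma c * t. An element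
   is stored as the polynomial with the same left coefficients; [skewpoly sigma]
   and [{poly S}] share their additive group but not their multiplication. *)
Definition skewpoly (S : comNzRingType) (sigma : {rmorphism S -> S}) : Type :=
  {poly S}.

Section SkewPoly.

Variables (S : comNzRingType) (sigma : {rmorphism S -> S}).

HB.instance Definition _ := GRing.Zmodule.copy (skewpoly sigma) {poly S}.

Implicit Types (p q r f g : skewpoly sigma) (c : S).

Lemma iter_rmorph0 j : iter j sigma 0 = 0.
Proof. by elim: j => //= j ->; rewrite rmorph0. Qed.

Lemma iter_rmorph1 j : iter j sigma 1 = 1.
Proof. by elim: j => //= j ->; rewrite rmorph1. Qed.

Lemma iter_rmorphD j x y :
  iter j sigma (x + y) = iter j sigma x + iter j sigma y.
Proof. by elim: j => //= j ->; rewrite rmorphD. Qed.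

Lemma iter_rmorphM j x y :
  iter j sigma (x * y) = iter j sigma x * iter j sigma y.
Proof. by elim: j => //= j ->; rewrite rmorphM. Qed.

Lemma iter_rmorph_sum j (I : Type) (s : seq I) (P : pred I) (F : I -> S) :
  iter j sigma (\sum_(i <- s | P i) F i) =
  \sum_(i <- s | P i) iter j sigma (F i).
Proof. by apply: (big_morph _ (iter_rmorphD j) (iter_rmorph0 j)). Qed.

Definition skew_mul p q : skewpoly sigma :=
  \poly_(i < (size p + size q).-1)
     \sum_(j < i.+1) p`_j * iter j sigma q`_(i - j).

Fact coef_skew_mul p q i :
  (skew_mul p q)`_i = \sum_(j < i.+1) p`_j * iter j sigma q`_(i - j).
Proof.
rewrite coef_poly ltn_predRL; case: leqP => // le_pq_i1.
rewrite big1 // => j _; have [lq_p_j|lt_j_p] := leqP (size p) j.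
  by rewrite nth_default ?mul0r.
rewrite [q`__]nth_default ?iter_rmorph0 ?mulr0 // leq_subRL -ltnS //.
by rewrite (leq_trans _ le_pq_i1) // ltn_add2r.
Qed.

Fact coef_skew_mul_rev p q i :
  (skew_mul p q)`_i = \sum_(j < i.+1) p`_(i - j) * iter (i - j) sigma q`_j.
Proof.
rewrite coef_skew_mul (reindex_inj rev_ord_inj) /=.
by apply: eq_bigr => j _; rewrite subSS subKn // -ltnS.
Qed.

Fact skew_mulA : associative skew_mul.
Proof.
move=> p q r; apply/polyP=> i; rewrite coef_skew_mul coef_skew_mul_rev.
pose coef3 j k :=
  p`_j * (iter j sigma q`_(i - j - k) * iter (i - k) sigma r`_k).
transitivity (\sum_(j < i.+1) \sum_(k < i.+1 | (k <= i - j)%N) coef3 j k).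
  apply: eq_bigr => /= j _; rewrite coef_skew_mul_rev iter_rmorph_sum.
  rewrite big_distrr /= (big_ord_narrow_leq (leq_subr _ _)) /=.
  apply: eq_bigr => k _; rewrite /coef3 iter_rmorphM -iterD /=.
  congr (_ * (_ * iter _ _ _)); rewrite subnAC subnKC // leq_subRL.
    by rewrite addnC -leq_subRL -1?ltnS // ltnW.
  by rewrite (leq_trans _ (leq_subr j i)) // -ltnS.
rewrite (exchange_big_dep predT) //=; apply: eq_bigr => k _.
transitivity (\sum_(j < i.+1 | (j <= i - k)%N) coef3 j k).
  apply: eq_bigl => j; rewrite -ltnS -(ltnS j) -!subSn ?leq_ord //.
  by rewrite -subn_gt0 -(subn_gt0 j) -!subnDA addnC.
rewrite (big_ord_narrow_leq (leq_subr _ _)) coef_skew_mul big_distrl /=.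
by apply: eq_bigr => j _; rewrite /coef3 -!subnDA addnC mulrA.
Qed.

Fact skew_mul1p : left_id (1%:P : skewpoly sigma) skew_mul.
Proof.
move=> p; apply/polyP => i; rewrite coef_skew_mul big_ord_recl subn0.
by rewrite big1 => [|j _]; rewrite coefC /= ?mul1r ?mul0r ?addr0.
Qed.

Fact skew_mulp1 : right_id (1%:P : skewpoly sigma) skew_mul.
Proof.
move=> p; apply/polyP => i; rewrite coef_skew_mul_rev big_ord_recl subn0.
rewrite big1 => [|j _]; rewrite coefC /= ?iter_rmorph0 ?mulr0 //.
by rewrite iter_rmorph1 mulr1 addr0.
Qed.

Fact skew_mulDl : left_distributive skew_mul +%R.
Proof.
move=> p q r; apply/polyP=> i; rewrite coefD !coef_skew_mul -big_split /=.
by apply: eq_bigr => j _; rewrite coefD mulrDl.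
Qed.

Fact skew_mulDr : right_distributive skew_mul +%R.
Proof.
move=> p q r; apply/polyP=> i; rewrite coefD !coef_skew_mul -big_split /=.
by apply: eq_bigr => j _; rewrite coefD iter_rmorphD mulrDr.
Qed.

Fact skew_1neq0 : (1%:P : skewpoly sigma) != 0.
Proof. exact: (oner_neq0 {poly S}). Qed.

HB.instance Definition _ := GRing.Zmodule_isNzRing.Build (skewpoly sigma)
  skew_mulA skew_mul1p skew_mulp1 skew_mulDl skew_mulDr skew_1neq0.

Definition skewC c : skewpoly sigma := c%:P.
Definition skewX : skewpoly sigma := 'X.

Lemma coef_skewCM c p i : (skewC c * p)`_i = c * p`_i.
Proof.
rewrite [LHS]coef_skew_mul big_ord_recl subn0 big1 => [|j _].
  by rewrite coefC addr0.
by rewrite coefC /= mul0r.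
Qed.

Lemma coef_skewXM p i :
  (skewX * p)`_i = if i is i'.+1 then sigma p`_i' else 0.
Proof.
rewrite [LHS]coef_skew_mul; case: i => [|i].
  by rewrite big_ord1 coefX mul0r.
rewrite !big_ord_recl big1 => [|j _]; last by rewrite coefX mul0r.
by rewrite !coefX /= mul0r add0r mul1r addr0 subSS subn0.
Qed.

Lemma skewXC c : skewX * skewC c = skewC (sigma c) * skewX.
Proof.
apply/polyP=> i; rewrite coef_skewXM coef_skewCM coefX.
case: i => [|i]; rewrite ?mulr0 // coefC.
by case: i => [|i] /=; rewrite ?mulr1 // rmorph0 mulr0.
Qed.

Lemma coef_skewXnM n p i :
  (skewX ^+ n * p)`_i = if (i < n)%N then 0 else iter n sigma p`_(i - n).
Proof.
elim: n i => [|n IHn] i; first by rewrite mul1r subn0.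
rewrite exprS -mulrA coef_skewXM; case: i => [|i] //.
by rewrite IHn ltnS subSS /=; case: ifP => // _; rewrite rmorph0.
Qed.

Lemma skewXnE n : (skewX ^+ n : skewpoly sigma) = ('X^n : {poly S}).
Proof.
apply/polyP=> i; rewrite -[skewX ^+ n]mulr1 coef_skewXnM coefXn.
have -> : (1 : skewpoly sigma)`_(i - n) = ((i - n)%N == 0)%:R.
  exact: coef1.
rewrite subn_eq0; case: ltngtP => //= _; first by rewrite iter_rmorph0.
by rewrite iter_rmorph1.
Qed.

(* Division with remainder g = q * f + r by a monic f (see [skew_rmodP] and
   [skew_rmod_uniq]): cancel the leading term of g with a left multiple of f
   until the degree is small enough; [size g] steps suffice. *)
Fixpoint skew_rmod_loop (fuel : nat) f g : skewpoly sigma :=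
  if fuel is fuel'.+1 then
    if (size g < size f)%N then g
    else skew_rmod_loop fuel' f
           (g - skewC (lead_coef g) * skewX ^+ (size g - size f) * f)
  else g.

Definition skew_rmod g f : skewpoly sigma := skew_rmod_loop (size g) f g.

Lemma skew_rmodP f g : f \is monic ->
  (exists q, g = q * f + skew_rmod g f) /\ (size (skew_rmod g f) < size f)%N.
Proof.
move=> fmon; rewrite /skew_rmod.
have sf : (0 < size f)%N by rewrite size_poly_gt0 monic_neq0.
suff H k : (size g <= k)%N -> (exists q, g = q * f + skew_rmod_loop k f g) /\
    (size (skew_rmod_loop k f g) < size f)%N by exact: H.
elim: k g => [|k IHk] g sg /=.
  split; first by exists 0; rewrite mul0r add0r.
  exact: leq_ltn_trans sg sf.
case: ltnP => sgf; first by split=> //; exists 0; rewrite mul0r add0r.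
have sg0 : (0 < size g)%N by apply: leq_trans sgf.
pose F : nat := size f; pose G : nat := size g.
have [F0 FG] : (0 < F)%N /\ (F <= G)%N by [].
set u := skewC _ * _.
have [|[q Eq] Hs] := IHk (g - u * f).
  rewrite -ltnS (leq_trans _ sg) // -[X in (_ < X)%N](prednK sg0) ltnS.
  apply/leq_sizeP => j lj; have {}lj : (G.-1 <= j)%N by [].
  rewrite coefB -mulrA coef_skewCM coef_skewXnM.
  have -> : (j < size g - size f)%N = false.
    by rewrite -/F -/G; apply/negbTE; rewrite -leqNgt; lia.
  have [Ej|nEj] := eqVneq j G.-1.
    have -> : (j - (size g - size f) = (size f).-1)%N.
      suff: (j - (G - F) = F.-1)%N by [].
      by lia.
    have := monicP fmon; rewrite lead_coefE => ->.
    by rewrite iter_rmorph1 mulr1 Ej -lead_coefE subrr.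
  rewrite [X in X - _]nth_default; last by suff: (G <= j)%N by []; lia.
  rewrite [f`__]nth_default.
    by rewrite iter_rmorph0 mulr0 subr0.
  by suff: (F <= j - (G - F))%N by []; lia.
split=> //; exists (u + q).
by rewrite mulrDl -addrA -Eq addrC subrK.
Qed.

Lemma skew_rmod_uniq f q q' r r' : f \is monic ->
  q * f + r = q' * f + r' -> (size r < size f)%N -> (size r' < size f)%N ->
  q = q' /\ r = r'.
Proof.
move=> fmon E sr sr'.
have sf : (0 < size f)%N by rewrite size_poly_gt0 monic_neq0.
have E' : (q - q') * f = r' - r.
  by apply/eqP; rewrite mulrBl subr_eq addrAC eq_sym subr_eq E addrC.
suff Eq : q - q' = 0.
  move/eqP: Eq; rewrite subr_eq0 => /eqP Eq; split=> //.
  by move: E; rewrite Eq => /addrI.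
apply/eqP/negPn/negP => nz; set p := q - q' in E' nz.
have sp : (0 < size p)%N by rewrite size_poly_gt0.
pose F : nat := size f; pose P : nat := size p.
have [F0 P0] : (0 < F)%N /\ (0 < P)%N by [].
have := congr1 (fun s : {poly S} => s`_(P.-1 + F.-1)) E'.
rewrite [RHS]nth_default; last first.
  have lF x : (x < F)%N -> (x <= P.-1 + F.-1)%N by lia.
  by rewrite (leq_trans (size_polyD _ _)) // size_polyN geq_max !lF.
rewrite [LHS]coef_skew_mul.
have lt : (P.-1 < (P.-1 + F.-1).+1)%N by lia.
rewrite (bigD1 (Ordinal lt)) //= big1 ?addr0 => [|j].
  rewrite addKn; have := monicP fmon; rewrite lead_coefE => ->.
  rewrite iter_rmorph1 mulr1 -lead_coefE => /eqP.
  by rewrite lead_coef_eq0 (negPf nz).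
rewrite -val_eqE /= => nj; have [lj|lj] := leqP P j.
  by rewrite nth_default ?mul0r.
rewrite [f`__]nth_default ?iter_rmorph0 ?mulr0 //.
by suff: (F <= P.-1 + F.-1 - j)%N by []; lia.
Qed.

Lemma skew_rmod_small f g : (size g < size f)%N -> skew_rmod g f = g.
Proof.
by move=> lt; rewrite /skew_rmod; case: {1}(size g) => //= k; rewrite lt.
Qed.

Lemma skew_binomE n c :
  (skewX ^+ n - skewC c : skewpoly sigma) = ('X^n - c%:P : {poly S}).
Proof. by rewrite skewXnE. Qed.

Lemma size_skew_binom n c : (0 < n)%N ->
  size (skewX ^+ n - skewC c : skewpoly sigma) = n.+1.
Proof. by move=> n0; rewrite skew_binomE size_XnsubC. Qed.

Lemma skew_binom_monic n c : (0 < n)%N ->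
  (skewX ^+ n - skewC c : skewpoly sigma) \is monic.
Proof. by move=> n0; rewrite skew_binomE; apply: monicXnsubC. Qed.

End SkewPoly.

Arguments skewC {S} sigma c.
Arguments skewX {S} sigma.

(* The additive group of the Petit ring S_f, f monic: the skew polynomials of
   degree less than deg f. *)
Definition petit (S : comNzRingType) (sigma : {rmorphism S -> S})
  (f : skewpoly sigma) : Type := {poly_((size f).-1) S}.

Section Petit.

Variables (S : comNzRingType) (sigma : {rmorphism S -> S}).
Variable f : skewpoly sigma.

HB.instance Definition _ :=
  GRing.Zmodule.copy (petit f) {poly_((size f).-1) S}.

Definition petit_val (g : petit f) : skewpoly sigma := polyn g.

(* The class g mod_r f. [npolyp] truncates to degree < deg f, which changes
   nothing when f is monic (see [in_petitE]). *)
Definition in_petit (g : skewpoly sigma) : petit f :=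
  npolyp _ (skew_rmod g f).

Definition petit_mul (g h : petit f) : petit f :=
  in_petit (petit_val g * petit_val h).

Definition petitC (c : S) : petit f := in_petit (skewC sigma c).
Definition petitX : petit f := in_petit (skewX sigma).

(* S_f is not associative: [petit_power x i y] holds when y is a product of i
   factors x for some parenthesization, and [petit_exp x i] is the power
   x (x (... (x 1))). *)
Inductive petit_power (x : petit f) : nat -> petit f -> Prop :=
| PetitPower1 : petit_power x 1 x
| PetitPowerM i j y z : petit_power x i y -> petit_power x j z ->
    petit_power x (i + j) (petit_mul y z).

Definition petit_exp (x : petit f) (i : nat) : petit f :=
  iter i (petit_mul x) (petitC 1).

Hypothesis fmon : f \is monic.

Lemma petit_valP (g : petit f) : (size (petit_val g) < size f)%N.
Proof.
have sf : (0 < size f)%N by rewrite size_poly_gt0 monic_neq0.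
rewrite -[X in (_ < X)%N](prednK sf) ltnS; exact: (size_npoly g).
Qed.

Lemma in_petitE (g : skewpoly sigma) : petit_val (in_petit g) = skew_rmod g f.
Proof.
rewrite /petit_val /in_petit npolypK //.
by have [_ lt] := skew_rmodP g fmon; rewrite -ltnS (ltn_predK lt).
Qed.

Lemma in_petit_small (g : skewpoly sigma) :
  (size g < size f)%N -> petit_val (in_petit g) = g.
Proof. by move=> lt; rewrite in_petitE skew_rmod_small. Qed.

Lemma petit_valK (g : petit f) : in_petit (petit_val g) = g.
Proof. by apply: val_inj; apply: in_petit_small; apply: petit_valP. Qed.

Lemma petit_powerX i y : petit_power petitX i y -> (i < (size f).-1)%N ->
  petit_val y = skewX sigma ^+ i.
Proof.
have szX j : (j < (size f).-1)%N ->
    (size (skewX sigma ^+ j : skewpoly sigma) < size f)%N.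
  by rewrite skewXnE size_polyXn; case: (size f).
elim=> [lt|j l u v _ IHu pv IHv lt]; first by rewrite in_petit_small ?(szX 1%N).
rewrite /petit_mul IHu ?IHv -?exprD ?in_petit_small ?szX //.
  exact: leq_ltn_trans (leq_addl _ _) lt.
exact: leq_ltn_trans (leq_addr _ _) lt.
Qed.

Lemma petit_expX i : (i < (size f).-1)%N ->
  petit_val (petit_exp petitX i) = skewX sigma ^+ i.
Proof.
have szX j : (j < (size f).-1)%N ->
    (size (skewX sigma ^+ j : skewpoly sigma) < size f)%N.
  by rewrite skewXnE size_polyXn; case: (size f).
elim: i => [|i IHi] lt; first by rewrite in_petit_small ?(szX 0%N).
have lt1 : (1 < (size f).-1)%N by apply: leq_ltn_trans lt.
rewrite /= /petit_mul IHi 1?ltnW // (in_petit_small (szX 1%N lt1)) -exprS.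
by rewrite in_petit_small ?szX.
Qed.

Lemma petit_sumE (g : petit f) : g =
  \sum_(i < (size f).-1)
    petit_mul (petitC (petit_val g)`_i) (petit_exp petitX i).
Proof.
have predS (l m : nat) : (l < m.-1)%N -> (l.+1 < m)%N by lia.
apply/npolyP => j; rewrite coefn_sum.
have E (i : 'I_(size f).-1) :
    (petit_mul (petitC (petit_val g)`_i) (petit_exp petitX i))`_j =
    (petit_val g)`_i * (j == i)%:R.
  have sC : (size (skewC sigma (petit_val g)`_i) < size f)%N.
    rewrite (leq_ltn_trans (size_polyC_leq1 _)) //.
    exact: leq_ltn_trans (predS _ _ (ltn_ord i)).
  rewrite -[polyn _]/(petit_val _) /petit_mul petit_expX // (in_petit_small sC).
  rewrite in_petit_small; first by rewrite coef_skewCM skewXnE coefXn.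
  apply: (@leq_ltn_trans (i.+1)); last exact: predS (ltn_ord i).
  apply/leq_sizeP => l il; rewrite coef_skewCM skewXnE coefXn.
  by rewrite gtn_eqF // mulr0.
rewrite (eq_bigr _ (fun i _ => E i)); have [lj|lj] := leqP (size f).-1 j.
  rewrite big1 ?[LHS]big_coef_npoly // => i _.
  by rewrite gtn_eqF ?mulr0 // (leq_trans _ lj).
rewrite (bigD1 (Ordinal lj)) //= eqxx mulr1 big1 ?addr0 // => i ni.
by rewrite eq_sym (negPf ni : (i == j :> nat) = false) mulr0.
Qed.

End Petit.

Arguments petitC {S sigma} f c.
Arguments petitX {S sigma} f.

Section PetitHom.

Variables (S : comNzRingType) (sigma : {rmorphism S -> S}).
Variables f h : skewpoly sigma.

Definition petit_ring_hom (G : petit f -> petit h) : Prop :=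
  [/\ {morph G : x y / x + y},
      {morph G : x y / petit_mul x y} &
      G (petitC f 1) = petitC h 1].

(* G is the ring homomorphism G_{tau,alpha,k}. That it is determined by its
   values on S and t, and that the powers of alpha t^k occurring in its closed
   formula do not depend on the parenthesization, follows: see
   [is_petit_G_sum] and [is_petit_G_power]. *)
Definition is_petit_G (tau : S -> S) (alpha : S) (k : nat)
    (G : petit f -> petit h) : Prop :=
  [/\ petit_ring_hom G,
      forall c : S, G (petitC f c) = petitC h (tau c) &
      G (petitX f) = in_petit h (skewC sigma alpha * skewX sigma ^+ k)].

Lemma is_petit_G_sum tau alpha k G : f \is monic ->
  is_petit_G tau alpha k G -> forall g : petit f,
  G g = \sum_(i < (size f).-1)
    petit_mul (petitC h (tau (petit_val g)`_i))
      (petit_exp (in_petit h (skewC sigma alpha * skewX sigma ^+ k)) i).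
Proof.
move=> fmon [[GD GM G1] GC GX] g; rewrite {1}(petit_sumE fmon g).
have G0 : G 0 = 0 by apply: (addrI (G 0)); rewrite -GD !addr0.
rewrite (big_morph G GD G0); apply: eq_bigr => i _.
rewrite GM GC -GX; congr petit_mul.
by elim: (i : nat) => //= j IHj; rewrite GM IHj.
Qed.

Lemma is_petit_G_power tau alpha k G : f \is monic ->
  is_petit_G tau alpha k G -> forall (i : nat) (y z : petit h),
  let x := in_petit h (skewC sigma alpha * skewX sigma ^+ k) in
  (i < (size f).-1)%N -> petit_power x i y -> petit_power x i z -> y = z.
Proof.
move=> fmon [[GD GM G1] GC GX] i y z /= lt; rewrite -GX => py pz.
have lift w : petit_power (G (petitX f)) i w ->
    exists2 v, petit_power (petitX f) i v & w = G v.
  elim=> [|j l u v _ [u' pu ->] _ [v' pv ->]].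
    by exists (petitX f) => //; apply: PetitPower1.
  by exists (petit_mul u' v'); [apply: PetitPowerM | rewrite GM].
have [[u pu ->] [v pv ->]] := (lift y py, lift z pz).
congr G; apply: val_inj; rewrite -[LHS]/(petit_val u) -[RHS]/(petit_val v).
by rewrite (petit_powerX fmon pu lt) (petit_powerX fmon pv lt).
Qed.

End PetitHom.

(* Main.v *)
Require Import Defs.
From HB Require Import structures.
From mathcomp Require Import all_boot all_order all_algebra.
From mathcomp Require Import zify.

Set Implicit Arguments.
Unset Strict Implicit.
Unset Printing Implicit Defensive.

Import GRing.Theory.
Local Open Scope ring_scope.

(* Everything is computed on monomials: in S_(t^n - b) one has
   c t^(i+n) = c sigma^i(b) t^i, and G (c t^i) = tau(c) A_i t^(ki), where
   A_i = alpha sigma^k(alpha) ... sigma^(k(i-1))(alpha); since only the left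
   factor of a Petit product has to be reduced beforehand, the latter holds for
   every i >= 0 and every homomorphism G.
   Necessity: t s = sigma(s) t gives (1). Choose i < n with n <= ki < 2n; then
   G (t^i) is a multiple of t^(ki-n), so t^i s = sigma^i(s) t^i forces
   ki - n = i mod m, whence (2), and t^i t = t^(i+1) forces sigma^k(b) = b.
   Finally t^n = a becomes A_n b^k = tau(a), which is (4) and whose left-hand
   side is fixed by sigma.
   Conversely the formula on monomials defines a homomorphism. It sends t^i to
   a multiple of t^(ki mod n), so it is bijective iff i |-> ki mod n permutes
   the exponents and all the coefficients A_i b^(ki / n) are units. *)

(** * Iterates of [sigma] and congruences modulo its order *)

Section IterRmorphism.

Variables (S : comUnitRingType) (sigma : {rmorphism S -> S}).

Lemma iter_rmorph_prod i (I : Type) (s : seq I) (P : pred I) (F : I -> S) :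
  iter i sigma (\prod_(l <- s | P l) F l) =
  \prod_(l <- s | P l) iter i sigma (F l).
Proof. exact: (big_morph _ (iter_rmorphM sigma i) (iter_rmorph1 sigma i)). Qed.

Lemma iter_rmorph_unit i x :
  x \is a GRing.unit -> iter i sigma x \is a GRing.unit.
Proof. by move=> ux; elim: i => //= i; apply: rmorph_unit. Qed.

Lemma iter_rmorph_lreg i x :
  bijective sigma -> GRing.lreg x -> GRing.lreg (iter i sigma x).
Proof.
case=> g gK Kg rx; elim: i => //= i IHi y z; rewrite -(Kg y) -(Kg z).
by rewrite -!rmorphM => /(can_inj gK)/IHi ->.
Qed.

End IterRmorphism.

Lemma iter_order_modn (T : Type) (s : T -> T) m i : iter m s =1 id ->
  iter (i %% m) s =1 iter i s.
Proof.
move=> sm x; rewrite [in RHS](divn_eq i m) addnC iterD; congr iter.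
by elim: (i %/ m)%N => //= q {1}->; rewrite mulSn iterD sm.
Qed.

(** Cancelling the smaller iterate by injectivity shows that [iter (j - i) s] is the identity. Hence
    so is the iterate of the remainder of [j - i] modulo [m], and minimality of [m] makes this
    remainder 0. *)
Lemma iter_eq_has_order (T : Type) (s : T -> T) m i j :
  injective s -> has_order s m -> iter i s =1 iter j s -> i = j %[mod m].
Proof.
move=> sI [m0 sm smin]; wlog le_ij : i j / (i <= j)%N => [hw E|E].
  case/orP: (leq_total i j) => le; first exact: hw.
  by apply/esym/hw => // x; rewrite E.
have sE x : iter (j - i) s x = x.
  have iI : injective (iter i s) by elim: (i) => //= l IHl x1 x2 /sI/IHl.
  by apply: iI; rewrite -iterD subnKC.
have [z|nz] := posnP ((j - i) %% m)%N.
  by apply/esym/eqP; rewrite eqn_mod_dvd //; apply/eqP.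
case: (smin ((j - i) %% m)%N); first by rewrite nz ltn_pmod.
by move=> x; rewrite iter_order_modn ?sE.
Qed.

(** * Twisted powers and the norm *)

Section TwistedPower.

Variables (S : comUnitRingType) (sigma : {rmorphism S -> S}).

(* The coefficient of (x t^k)^i in S[t; sigma]. *)
Definition twisted_power (x : S) (k i : nat) : S :=
  \prod_(l < i) iter (k * l) sigma x.

Lemma twisted_powerD x k i j : twisted_power x k (i + j) =
  twisted_power x k i * iter (k * i) sigma (twisted_power x k j).
Proof.
rewrite /twisted_power big_split_ord /= iter_rmorph_prod; congr (_ * _).
by apply: eq_bigr => l _; rewrite -iterD mulnDr.
Qed.

Lemma twisted_power0 x k : twisted_power x k 0 = 1.
Proof. exact: big_ord0. Qed.

Lemma twisted_power1 x k : twisted_power x k 1 = x.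
Proof. by rewrite /twisted_power big_ord1 muln0. Qed.

Lemma twisted_power_unit x k i :
  x \is a GRing.unit -> twisted_power x k i \is a GRing.unit.
Proof.
by move=> ux; apply: rpred_prod => l _; apply: iter_rmorph_unit.
Qed.

Lemma twisted_power_lreg x k i :
  bijective sigma -> GRing.lreg x -> GRing.lreg (twisted_power x k i).
Proof.
move=> sb rx; apply: big_ind => [y z||l _]; first by rewrite !mul1r.
  exact: lregM.
exact: iter_rmorph_lreg.
Qed.

Lemma cyclic_norm_fixed m x :
  iter m sigma =1 id -> sigma (cyclic_norm sigma m x) = cyclic_norm sigma m x.
Proof.
case: m => [|m] sm; first by rewrite /cyclic_norm big_ord0 rmorph1.
rewrite /cyclic_norm rmorph_prod big_ord_recr big_ord_recl /= mulrC.
by rewrite -[sigma (iter m sigma x)]/(iter m.+1 sigma x) sm.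
Qed.

(** The product splits into [n %/ m] blocks of [m] factors. Since k = 1 mod m, each block is the
    norm, and the shift by [k * m] between blocks acts trivially. *)
Lemma twisted_power_norm m x k n : iter m sigma =1 id -> k = 1 %[mod m] ->
  (m %| n)%N -> twisted_power x k n = cyclic_norm sigma m x ^+ (n %/ m).
Proof.
move=> sm k1 /dvdnP[q ->]; case: (posnP m) => [->|m0].
  by rewrite muln0 divn0 expr0 twisted_power0.
rewrite mulnK //; elim: q => [|q IHq].
  by rewrite mul0n expr0 twisted_power0.
rewrite mulSn twisted_powerD IHq exprS; congr (_ * _).
  apply: eq_bigr => l _; rewrite -(iter_order_modn _ sm).
  by rewrite -modnMml k1 modnMml mul1n iter_order_modn.
rewrite -(iter_order_modn _ sm) modnMl /=.
by [].
Qed.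

End TwistedPower.

(** * Monomial arithmetic modulo t^n - b *)

Section PetitVal.

Variables (S : comNzRingType) (sigma : {rmorphism S -> S}) (f : skewpoly sigma).

Lemma petit_val_inj : injective (@petit_val _ _ f).
Proof. exact: val_inj. Qed.

Lemma petit_valD (u v : petit f) : petit_val (u + v) = petit_val u + petit_val v.
Proof. by []. Qed.

End PetitVal.

Section PetitBinomial.

Variables (S : comUnitRingType) (sigma : {rmorphism S -> S}).
Variables (n : nat) (b : S).
Hypothesis n_gt0 : (0 < n)%N.

Local Notation f := (skewX sigma ^+ n - skewC sigma b).
Let fmon : f \is monic := skew_binom_monic sigma b n_gt0.

Lemma skew_rmodMDr q g : skew_rmod (q * f + g) f = skew_rmod g f.
Proof.
have [[q1 E1] s1] := skew_rmodP (q * f + g) fmon.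
have [[q2 E2] s2] := skew_rmodP g fmon.
have [] // := @skew_rmod_uniq _ _ f q1 (q + q2) _ _ fmon _ s1 s2.
by rewrite -E1 mulrDl -addrA -E2.
Qed.

Lemma skew_rmodD g h : skew_rmod (g + h) f = skew_rmod g f + skew_rmod h f.
Proof.
have [[q1 E1] s1] := skew_rmodP g fmon.
have [[q2 E2] s2] := skew_rmodP h fmon.
rewrite {1}E1 {1}E2 addrACA -mulrDl skew_rmodMDr skew_rmod_small //.
by rewrite (leq_ltn_trans (size_polyD _ _)) // gtn_max s1.
Qed.

Lemma in_petitD g h : in_petit f (g + h) = in_petit f g + in_petit f h.
Proof.
by apply: petit_val_inj; rewrite in_petitE // skew_rmodD -!in_petitE.
Qed.

Lemma petit_mulDl (u v w : petit f) :
  petit_mul (u + v) w = petit_mul u w + petit_mul v w.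
Proof. by rewrite /petit_mul petit_valD mulrDl in_petitD. Qed.

Lemma petit_mulDr (u v w : petit f) :
  petit_mul u (v + w) = petit_mul u v + petit_mul u w.
Proof. by rewrite /petit_mul petit_valD mulrDr in_petitD. Qed.

Lemma petit_mul_suml (I : Type) (r : seq I) (F : I -> petit f) w :
  petit_mul (\sum_(i <- r) F i) w = \sum_(i <- r) petit_mul (F i) w.
Proof.
apply: (big_morph (fun u => petit_mul u w) (fun u v => petit_mulDl u v w)).
by apply: (addrI (petit_mul 0 w)); rewrite -petit_mulDl !addr0.
Qed.

Lemma petit_mul_sumr (I : Type) (r : seq I) (F : I -> petit f) w :
  petit_mul w (\sum_(i <- r) F i) = \sum_(i <- r) petit_mul w (F i).
Proof.
apply: (big_morph (petit_mul w) (petit_mulDr w)).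
by apply: (addrI (petit_mul w 0)); rewrite -petit_mulDr !addr0.
Qed.

(* Only the left factor has to be reduced beforehand: the kernel of [in_petit]
   is the left ideal S[t; sigma] f. *)
Lemma petit_mul_in u g :
  petit_mul u (in_petit f g) = in_petit f (petit_val u * g).
Proof.
apply: petit_val_inj; rewrite /petit_mul !in_petitE //.
have [[q E] _] := skew_rmodP g fmon.
by rewrite {2}E mulrDr mulrA skew_rmodMDr.
Qed.

(** The exponent is unrestricted, so product formulas can be stated without separating the case in
    which t^n has to be reduced. *)
Definition petit_mon (c : S) (i : nat) : petit f :=
  in_petit f (skewC sigma c * skewX sigma ^+ i).

Lemma coef_skew_mon c i j :
  (skewC sigma c * skewX sigma ^+ i)`_j = c * (j == i)%:R.
Proof. by rewrite coef_skewCM skewXnE coefXn. Qed.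

Lemma petit_val_mon c i : (i < n)%N ->
  petit_val (petit_mon c i) = skewC sigma c * skewX sigma ^+ i.
Proof.
move=> lt; rewrite in_petit_small // size_skew_binom // ltnS.
apply: leq_trans lt; apply/leq_sizeP => j lj.
by rewrite coef_skew_mon gtn_eqF // mulr0.
Qed.

Lemma coef_petit_mon c i j : (i < n)%N ->
  (petit_val (petit_mon c i))`_j = c * (j == i)%:R.
Proof. by move=> lt; rewrite petit_val_mon // coef_skew_mon. Qed.

Lemma petit_monC c : petit_mon c 0 = petitC f c.
Proof. by rewrite /petit_mon expr0 mulr1. Qed.

Lemma petit_mon1X : petit_mon 1 1 = petitX f.
Proof. by rewrite /petit_mon expr1 [skewC _ 1 * _]mul1r. Qed.

Lemma petit_monD c d i : petit_mon (c + d) i = petit_mon c i + petit_mon d i.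
Proof. by rewrite /petit_mon -in_petitD -mulrDl /skewC polyCD. Qed.

Lemma skewXnC i c :
  skewX sigma ^+ i * skewC sigma c =
  skewC sigma (iter i sigma c) * skewX sigma ^+ i.
Proof.
elim: i => [|i IHi]; first by rewrite !expr0 mul1r mulr1.
by rewrite exprS -mulrA IHi mulrA skewXC -mulrA.
Qed.

Lemma skewCM c d : skewC sigma (c * d) = skewC sigma c * skewC sigma d.
Proof.
by apply/polyP=> i; rewrite coef_skewCM !coefC; case: ifP; rewrite ?mulr0.
Qed.

Lemma skew_monM c i d j :
  skewC sigma c * skewX sigma ^+ i * (skewC sigma d * skewX sigma ^+ j) =
  skewC sigma (c * iter i sigma d) * skewX sigma ^+ (i + j).
Proof.
by rewrite -mulrA (mulrA (_ ^+ i)) skewXnC skewCM exprD !mulrA.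
Qed.

Lemma petit_monM c i d j : (i < n)%N ->
  petit_mul (petit_mon c i) (petit_mon d j) =
  petit_mon (c * iter i sigma d) (i + j).
Proof. by move=> lt; rewrite petit_mul_in petit_val_mon // skew_monM. Qed.

Lemma petit_mon_addn c i : petit_mon c (i + n) = petit_mon (c * iter i sigma b) i.
Proof.
apply: petit_val_inj; rewrite !in_petitE //.
rewrite -[RHS](skew_rmodMDr (skewC sigma c * skewX sigma ^+ i)) mulrBr.
have := skew_monM c i b 0; rewrite expr0 mulr1 addn0 => ->.
by rewrite subrK exprD mulrA.
Qed.

(** Each reduction by t^n multiplies the coefficient by the unit sigma^(i-n)(b); once the exponent
    is below n, the coefficient can be read off. *)
Lemma petit_mon_inj i : b \is a GRing.unit -> injective (petit_mon^~ i).
Proof.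
move=> ub; have [N] := ubnP i; elim: N i => // N IHN i lt c d.
have [le|lti] := leqP n i.
  rewrite -(subnK le) !petit_mon_addn => E.
  apply: (mulIr (iter_rmorph_unit sigma (i - n) ub)).
  by apply: IHN E; move: n_gt0 lt le; lia.
move=> /(congr1 (fun u => (petit_val u)`_i)).
by rewrite !coef_petit_mon // eqxx !mulr1.
Qed.

Lemma petit_mon_sum (g : petit f) :
  g = \sum_(i < n) petit_mon (petit_val g)`_i i.
Proof.
apply: petit_val_inj; rewrite (big_morph _ (@petit_valD _ _ _) erefl).
apply/polyP => j; rewrite coef_sum.
have [lj|lj] := leqP n j.
  rewrite nth_default; last first.
    by rewrite -ltnS (leq_trans (petit_valP fmon g)) // size_skew_binom.
  rewrite big1 // => i _.
  by rewrite coef_petit_mon // gtn_eqF ?mulr0 // (leq_trans _ lj).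
rewrite (bigD1 (Ordinal lj)) //= coef_petit_mon // eqxx mulr1 big1 ?addr0 //.
move=> i; rewrite -val_eqE coef_petit_mon //= eq_sym => /negPf->.
by rewrite mulr0.
Qed.

Lemma petit_mon_modn c i : sigma b = b ->
  petit_mon c i = petit_mon (c * b ^+ (i %/ n)) (i %% n).
Proof.
move=> sb; have sbi j : iter j sigma b = b by elim: j => //= j ->.
rewrite {1}(divn_eq i n); elim: (i %/ n)%N c => [|q IHq] c.
  by rewrite mul0n expr0 mulr1.
by rewrite mulSn -addnA addnC petit_mon_addn sbi IHq exprS mulrA.
Qed.

(** Here t^n - b is central in S[t; sigma], so unlike in [petit_monM] the left exponent may be n or
    more. *)
Lemma petit_monM_central m c i d j : iter m sigma =1 id -> (m %| n)%N ->
  sigma b = b ->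
  petit_mul (petit_mon c i) (petit_mon d j) =
  petit_mon (c * iter i sigma d) (i + j).
Proof.
move=> sm mn sb; rewrite (petit_mon_modn c i) // petit_monM ?ltn_pmod //.
rewrite [RHS](_ : _ =
    petit_mon (c * iter i sigma d * b ^+ (i %/ n)) (i %% n + j)).
  rewrite mulrAC; congr (petit_mon (_ * _ * _) _).
  by rewrite -(iter_order_modn _ sm) modn_dvdm // iter_order_modn.
rewrite [LHS]petit_mon_modn // [RHS]petit_mon_modn // modnDml; congr petit_mon.
rewrite -!mulrA -exprD; congr (_ * (_ * _ ^+ _)).
by rewrite {1}(divn_eq i n) -addnA divnMDl.
Qed.

End PetitBinomial.

Arguments petit_mon {S} sigma n b c i.

Lemma petit_mon0 (S : comUnitRingType) (sigma : {rmorphism S -> S}) n b i :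
  (0 < n)%N -> petit_mon sigma n b 0 i = 0.
Proof.
move=> n0; apply: (addrI (petit_mon sigma n b 0 i)).
by rewrite -petit_monD // !addr0.
Qed.

Lemma petit_mon_addMn (S : comUnitRingType) (sigma : {rmorphism S -> S})
    n b c i q :
  (0 < n)%N -> sigma b = b ->
  petit_mon sigma n b c (i + q * n) = petit_mon sigma n b (c * b ^+ q) i.
Proof.
move=> n0 sb; rewrite petit_mon_modn // [RHS]petit_mon_modn //.
by rewrite addnC modnMDl divnMDl // exprD mulrA.
Qed.

Lemma petit_coef_inj (S : comUnitRingType) (sigma : {rmorphism S -> S}) n b
    (u v : petit (skewX sigma ^+ n - skewC sigma b)) : (0 < n)%N ->
  (forall i, (i < n)%N -> (petit_val u)`_i = (petit_val v)`_i) -> u = v.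
Proof.
move=> n0 E; rewrite (petit_mon_sum n0 u) (petit_mon_sum n0 v).
by apply: eq_bigr => i _; rewrite E.
Qed.

(** A Bezout coefficient of k inverts the map i |-> ki on exponents modulo n. *)
Lemma coprime_invmod k n : (0 < k)%N -> coprime k n ->
  exists u, forall i, (u * (k * i) = i %[mod n])%N.
Proof.
move=> k0 /(coprimeP _ k0)[[u v] /= E]; exists u => i.
have -> : (u * (k * i) = v * i * n + i)%N by nia.
by rewrite modnMDl.
Qed.

(** * Homomorphisms on monomials, and necessity of the conditions *)

Section PetitHomBinomial.

Variables (S : comUnitRingType) (sigma tau : {rmorphism S -> S}).
Variables (m n k : nat) (a b alpha : S).
Hypothesis sigma_bij : bijective sigma.
Hypothesis sigma_order : has_order sigma m.
Hypothesis b_unit : b \is a GRing.unit.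
Hypothesis tau_bij : bijective tau.
Hypothesis tau_sigma : forall s : S, tau (sigma s) = sigma (tau s).
Hypothesis alpha_reg : GRing.lreg alpha.
Hypotheses (k_ge2 : (2 <= k)%N) (k_lt_n : (k < n)%N).

Local Notation f := (skewX sigma ^+ n - skewC sigma a).
Local Notation h := (skewX sigma ^+ n - skewC sigma b).
Local Notation A := (twisted_power sigma alpha k).

Let n_gt0 : (0 < n)%N. Proof. exact: leq_ltn_trans k_lt_n. Qed.
Let n_gt1 : (1 < n)%N. Proof. exact: ltn_trans k_ge2 k_lt_n. Qed.

Lemma iter_tau i s : tau (iter i sigma s) = iter i sigma (tau s).
Proof. by elim: i => //= i <-. Qed.

(** Splitting c t^i as c times t^i, and t^(i+1) as t times t^i, keeps the left factors at degree 0
    or 1 and their images at degree 0 or k, all below n. So [petit_monM] applies on both sides for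
    every [i]. *)
Lemma is_petit_G_mon (G : petit f -> petit h) : is_petit_G tau alpha k G ->
  forall c i, G (petit_mon sigma n a c i) =
              petit_mon sigma n b (tau c * A i) (k * i).
Proof.
move=> [[GD GM G1] GC GX] c i.
have -> : petit_mon sigma n a c i =
    petit_mul (petit_mon sigma n a c 0) (petit_mon sigma n a 1 i).
  by rewrite petit_monM //= mulr1.
rewrite GM petit_monC GC -petit_monC.
suff -> : G (petit_mon sigma n a 1 i) = petit_mon sigma n b (A i) (k * i).
  by rewrite petit_monM.
elim: i => [|i IHi].
  by rewrite muln0 twisted_power0 !petit_monC G1.
have -> : petit_mon sigma n a 1 i.+1 =
    petit_mul (petit_mon sigma n a 1 1) (petit_mon sigma n a 1 i).
  by rewrite petit_monM //= mul1r rmorph1.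
rewrite GM IHi petit_mon1X GX -[in_petit _ _]/(petit_mon sigma n b alpha k).
by rewrite petit_monM // -mulnS -[i.+1]add1n twisted_powerD twisted_power1 muln1.
Qed.

Lemma is_petit_G_conditions (G : petit f -> petit h) : is_petit_G tau alpha k G ->
  [/\ k = 1 %[mod m], (m %| n)%N, sigma a = a /\ sigma b = b &
      cyclic_norm sigma m alpha ^+ (n %/ m) * b ^+ k = tau a].
Proof.
move=> GP; have GE := is_petit_G_mon GP; have [[_ GM _] _ _] := GP.
have [tau' tauK tau'K] := tau_bij; have sI := bij_inj sigma_bij.
have [m0 sm _] := sigma_order.
have Areg i : GRing.lreg (A i) by exact: twisted_power_lreg.
have k1 : k = 1 %[mod m].
  apply: (iter_eq_has_order sI sigma_order) => s /=.
  (* As [tau] is onto, it suffices to test elements tau(s); G(t s) = G(t) G(s) then gives the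
     equality after cancelling [alpha]. *)
  rewrite -(tau'K s); move: (tau' s) => {}s.
  have := GM (petit_mon sigma n a 1 1) (petit_mon sigma n a s 0).
  rewrite petit_monM // !GE petit_monM ?muln1 //.
  rewrite addn0 ?muln1 !muln0 addn0 => /(petit_mon_inj n_gt0 b_unit).
  rewrite mul1r /= rmorph1 mul1r twisted_power0 mulr1.
  rewrite mulrC tau_sigma => E.
  exact/esym/(Areg 1).
have ski i s : iter (k * i) sigma s = iter i sigma s.
  by rewrite -(iter_order_modn _ sm) -modnMml k1 modnMml mul1n iter_order_modn.
(* For this i the image of t^i wraps around t^n exactly once, so comparing
   t^i * s and t^i * t with their images exposes the reduction by t^n - b. *)
pose i := (n %/ k).+1; pose e := (k * i - n)%N.
(* Writing n = qk + r with r < k gives i = q + 1 and e = k - r <= k < n; also q + 1 < n because k >=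
   2 and n >= 3. *)
have [ein lt_in lt_en] : [/\ (k * i = e + n)%N, (i < n)%N & (e < n)%N].
  have := divn_eq n k; have := ltn_pmod n (ltnW k_ge2).
  by rewrite /e /i; split; nia.
have breg j : GRing.lreg (iter j sigma b).
  by apply: mulrI; apply: iter_rmorph_unit.
have Gti : G (petit_mon sigma n a 1 i) =
    petit_mon sigma n b (A i * iter e sigma b) e.
  by rewrite GE ein petit_mon_addn // rmorph1 mul1r.
have ei : e = i %[mod m].
  apply: (iter_eq_has_order sI sigma_order) => s /=.
  rewrite -(tau'K s); move: (tau' s) => {}s.
  have := GM (petit_mon sigma n a 1 i) (petit_mon sigma n a s 0).
  rewrite petit_monM // Gti !GE addn0 ein petit_mon_addn // petit_monM //.
  rewrite muln0 addn0 => /(petit_mon_inj n_gt0 b_unit).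
  rewrite mul1r twisted_power0 mulr1.
  rewrite -mulrA mulrC iter_tau => /(lregM (Areg i) (breg e)) E.
  exact/esym.
have mn : (m %| n)%N.
  (* Modulo m, e + n = ki = i = e. *)
  have : e + n = e + 0 %[mod m].
    by rewrite -ein -modnMml k1 modnMml mul1n addn0.
  by move/eqP; rewrite eqn_modDl mod0n.
have sb : sigma b = b.
  (* At exponent e + k, G(t^(i+1)) has coefficient A_i sigma^(ki)(alpha) sigma^(e+k)(b), while
     G(t^i) G(t) has A_i sigma^e(b) sigma^e(alpha). Since ki = i = e mod m, cancellation leaves
     sigma^k(b) = b. *)
  have := GM (petit_mon sigma n a 1 i) (petit_mon sigma n a 1 1).
  rewrite petit_monM // Gti !GE petit_monM //.
  rewrite mulnDr muln1 ein addnAC petit_mon_addn //.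
  move=> /(petit_mon_inj n_gt0 b_unit).
  rewrite iter_rmorph1 mulr1 rmorph1 !mul1r twisted_powerD ein.
  rewrite twisted_power1 -mulrA -mulrA => /(Areg i).
  have -> : iter (e + n) sigma alpha = iter e sigma alpha.
    by rewrite -ein ski -(iter_order_modn _ sm) -ei iter_order_modn.
  rewrite [RHS]mulrC => /(iter_rmorph_lreg sigma_bij alpha_reg).
  have iI : injective (iter e sigma) by elim: (e) => //= l IHl x y /sI/IHl.
  rewrite iterD => /iI; rewrite -(iter_order_modn _ sm) k1.
  by rewrite iter_order_modn.
have E4 : cyclic_norm sigma m alpha ^+ (n %/ m) * b ^+ k = tau a.
  rewrite -(twisted_power_norm _ sm k1 mn).
  have : petit_mon sigma n a 1 (0 + n) = petit_mon sigma n a a 0.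
    by rewrite petit_mon_addn //= mul1r.
  move/(congr1 G); rewrite !GE -[(k * (0 + n))%N]add0n petit_mon_addMn // muln0.
  move=> /(petit_mon_inj n_gt0 b_unit).
  by rewrite rmorph1 mul1r ?add0n => ->; rewrite twisted_power0 mulr1.
split=> //; split=> //; apply: (bij_inj tau_bij).
rewrite tau_sigma -E4 rmorphM !rmorphXn sb /=.
by rewrite cyclic_norm_fixed.
Qed.

(** * Sufficiency: the map defined by the formula on monomials *)

Definition petit_G (g : petit f) : petit h :=
  \sum_(i < n) petit_mon sigma n b (tau (petit_val g)`_i * A i) (k * i).

Section Sufficiency.

Hypothesis k_mod : k = 1 %[mod m].
Hypothesis m_dvd_n : (m %| n)%N.
Hypothesis sigma_a : sigma a = a.
Hypothesis sigma_b : sigma b = b.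
Hypothesis norm_alpha : cyclic_norm sigma m alpha ^+ (n %/ m) * b ^+ k = tau a.

Let sm : iter m sigma =1 id. Proof. by case: sigma_order. Qed.

(** For i < n this is the definition. Larger exponents use t^n = a in the source and A_n t^(kn) =
    A_n b^k in the target; condition (4) makes the two agree. *)
Lemma petit_G_mon c i : petit_G (petit_mon sigma n a c i) =
  petit_mon sigma n b (tau c * A i) (k * i).
Proof.
rewrite petit_mon_modn // /petit_G (bigD1 (Ordinal (ltn_pmod i n_gt0))) //=.
rewrite coef_petit_mon ?ltn_pmod // eqxx mulr1 big1 ?addr0; last first.
  move=> j; rewrite -val_eqE /= => nj.
  rewrite coef_petit_mon ?ltn_pmod // (negPf nj).
  by rewrite mulr0 rmorph0 mul0r petit_mon0.
have skn s : iter (k * n) sigma s = s.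
  have /dvdnP[q ->] := dvdn_mull k m_dvd_n.
  by elim: q => //= q IHq; rewrite mulSn iterD IHq sm.
rewrite [in RHS](divn_eq i n); elim: (i %/ n)%N c => [|q IHq] c.
  by rewrite expr0 mulr1 mul0n add0n.
rewrite exprS mulrA IHq mulSn -addnA.
move: (q * n + _)%N => j; rewrite mulnDr [(k * n + _)%N]addnC petit_mon_addMn //.
rewrite twisted_powerD skn rmorphM -norm_alpha.
rewrite -(twisted_power_norm _ sm k_mod m_dvd_n) -!mulrA.
by congr (petit_mon _ _ _ (_ * (_ * _)) _); rewrite mulrC.
Qed.

Lemma petit_GD : {morph petit_G : u v / u + v}.
Proof.
move=> u v; rewrite /petit_G -big_split; apply: eq_bigr => i _.
by rewrite petit_valD coefD rmorphD mulrDl petit_monD.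
Qed.

(** By biadditivity only monomials matter. There the coefficients agree because A_(i+j) = A_i
    sigma^(ki)(A_j) and sigma^(ki) = sigma^i. *)
Lemma petit_GM : {morph petit_G : u v / petit_mul u v}.
Proof.
have G0 : petit_G 0 = 0 by apply: (addrI (petit_G 0)); rewrite -petit_GD !addr0.
move=> u v; rewrite (petit_mon_sum n_gt0 u) (petit_mon_sum n_gt0 v).
rewrite petit_mul_suml // !(big_morph _ petit_GD G0) petit_mul_suml //.
apply: eq_bigr => i _; rewrite !petit_mul_sumr // (big_morph _ petit_GD G0).
apply: eq_bigr => j _; rewrite petit_monM // !petit_G_mon.
rewrite (petit_monM_central _ _ _ _ _ sm) // mulnDr; congr petit_mon.
have ski s : iter (k * i) sigma s = iter i sigma s.
  by rewrite -(iter_order_modn _ sm) -modnMml k_mod modnMml mul1n iter_order_modn.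
rewrite twisted_powerD rmorphM iter_rmorphM !ski iter_tau -!mulrA.
by congr (_ * _); rewrite mulrCA.
Qed.

Lemma petit_G_is_petit_G : is_petit_G tau alpha k petit_G.
Proof.
have GC c : petit_G (petitC f c) = petitC h (tau c).
  by rewrite -!petit_monC petit_G_mon twisted_power0 mulr1 muln0.
split=> //; first split; rewrite ?GC ?rmorph1 //.
- exact: petit_GD.
- exact: petit_GM.
by rewrite -petit_mon1X petit_G_mon rmorph1 mul1r muln1 twisted_power1.
Qed.

(** * Bijectivity, read off from coefficients *)

Lemma coef_is_petit_G (G : petit f -> petit h) : is_petit_G tau alpha k G ->
  forall g j, (petit_val (G g))`_j =
    \sum_(i < n) tau (petit_val g)`_i * (A i * b ^+ (k * i %/ n)%N) *
                 (j == k * i %% n)%N%:R.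
Proof.
move=> GP g j; have [[GD _ _] _ _] := GP.
have G0 : G 0 = 0 by apply: (addrI (G 0)); rewrite -GD !addr0.
rewrite {1}(petit_mon_sum n_gt0 g) (big_morph G GD G0).
rewrite (big_morph _ (@petit_valD _ _ _) erefl) coef_sum.
apply: eq_bigr => i _; rewrite (is_petit_G_mon GP) petit_mon_modn //.
by rewrite coef_petit_mon ?ltn_pmod // mulrA.
Qed.

(** Multiplication by k is injective modulo n, so exactly one summand of [coef_is_petit_G]
    survives. *)
Lemma coef_is_petit_G_coprime (G : petit f -> petit h) :
  is_petit_G tau alpha k G -> coprime k n ->
  forall g i, (i < n)%N -> (petit_val (G g))`_(k * i %% n)%N =
    tau (petit_val g)`_i * (A i * b ^+ (k * i %/ n)%N).
Proof.
move=> GP co g i lt; rewrite (coef_is_petit_G GP).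
rewrite (bigD1 (Ordinal lt)) //= eqxx mulr1 big1 ?addr0 // => j.
rewrite -val_eqE /= => nj; case: eqP => [E|_]; last by rewrite mulr0.
have [u uK] := coprime_invmod (ltnW k_ge2) co.
case/eqP: nj; rewrite -(modn_small lt) -(modn_small (ltn_ord j)).
by rewrite -(uK i) -(uK j) -modnMmr -E modnMmr.
Qed.

Lemma is_petit_G_bijP (G : petit f -> petit h) : is_petit_G tau alpha k G ->
  bijective G <-> coprime k n /\ alpha \is a GRing.unit.
Proof.
move=> GP; split=> [[G' _ G'K]|[co ua]].
  have co : coprime k n.
    (* Since t has a preimage, some ki must be 1 mod n; otherwise its coefficient 1 would be an
       empty sum. *)
    have /(congr1 (fun u => (petit_val u)`_1)) := G'K (petit_mon sigma n b 1 1).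
    rewrite coef_petit_mon // eqxx mulr1 (coef_is_petit_G GP).
    have [i /eqP E|nex] := pickP (fun i : 'I_n => 1%N == (k * i %% n)%N).
      have : coprime (k * i) n by rewrite -coprime_modl -E coprime1n.
      by rewrite coprimeMl => /andP[].
    rewrite big1 => [/eqP|i _]; last by rewrite nex mulr0.
    by rewrite eq_sym oner_eq0.
  split=> //.
  (* The coefficient of t^k in the image of a preimage of t^k is 1, and it is a multiple of A_1 =
     alpha. *)
  have /(congr1 (fun u => (petit_val u)`_(k * 1 %% n)%N)) :=
    G'K (petit_mon sigma n b 1 k).
  rewrite (coef_is_petit_G_coprime GP) // muln1 modn_small //.
  rewrite coef_petit_mon // eqxx mulr1 divn_small // expr0 mulr1.
  by rewrite twisted_power1 => E; apply/unitrPr; exists (tau (petit_val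
    (G' (petit_mon sigma n b 1 k)))`_1); rewrite mulrC.
have [tau' tauK tau'K] := tau_bij.
pose c i := A i * b ^+ (k * i %/ n)%N.
have uc i : c i \is a GRing.unit.
  by rewrite unitrM unitrX // andbT; apply: twisted_power_unit.
(* The inverse takes the coefficient at ki mod n, divides by the unit [c i] and undoes [tau]. *)
pose G' (y : petit h) : petit f :=
  \sum_(i < n) petit_mon sigma n a (tau' ((petit_val y)`_(k * i %% n)%N / c i)) i.
have coefG' y i : (i < n)%N ->
    (petit_val (G' y))`_i = tau' ((petit_val y)`_(k * i %% n)%N / c i).
  move=> lt; rewrite /G' (big_morph _ (@petit_valD _ _ _) erefl) coef_sum.
  rewrite (bigD1 (Ordinal lt)) //= coef_petit_mon // eqxx mulr1 big1 ?addr0 //.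
  move=> j; rewrite -val_eqE eq_sym /= => nj.
  by rewrite coef_petit_mon // (negPf nj) mulr0.
exists G' => [g|y]; apply: petit_coef_inj => // i lt.
  rewrite coefG' // (coef_is_petit_G_coprime GP) //.
  by rewrite -/(c i) (mulrK (uc i)) tauK.
have [u uK] := coprime_invmod (ltnW k_ge2) co.
(* Every exponent below n is of the form kj mod n, here with j = ui mod n. *)
have -> : i = (k * (u * i %% n) %% n)%N.
  by rewrite modnMmr mulnCA uK modn_small.
rewrite (coef_is_petit_G_coprime GP) ?ltn_pmod // coefG' ?ltn_pmod //.
by rewrite tau'K (divrK (uc _)).
Qed.

End Sufficiency.

End PetitHomBinomial.

Theorem theorem4p4 (S : comUnitRingType) (sigma : {rmorphism S -> S}) (m : nat)
    (a b : S) (tau : {rmorphism S -> S}) (alpha : S) (n k : nat)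
    (sigma_bij : bijective sigma) (sigma_order : has_order sigma m)
    (a_unit : a \is a GRing.unit) (b_unit : b \is a GRing.unit)
    (tau_bij : bijective tau)
    (tau_sigma : forall s : S, tau (sigma s) = sigma (tau s))
    (alpha_reg : GRing.lreg alpha) (k_ge2 : (2 <= k)%N) (k_lt_n : (k < n)%N) :
  let f := skewX sigma ^+ n - skewC sigma a in
  let h := skewX sigma ^+ n - skewC sigma b in
  let conditions_1_to_4 :=
    [/\ k = 1 %[mod m],
        (m %| n)%N,
        sigma a = a /\ sigma b = b &
        cyclic_norm sigma m alpha ^+ (n %/ m) * b ^+ k = tau a] in
  ((exists G : petit f -> petit h, is_petit_G tau alpha k G) <->
     conditions_1_to_4) /\
  ((exists G : petit f -> petit h, is_petit_G tau alpha k G /\ bijective G) <->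
     conditions_1_to_4 /\ (coprime k n /\ alpha \is a GRing.unit)).
Proof.
move=> f h conditions_1_to_4.
have nec (G : petit f -> petit h) : is_petit_G tau alpha k G -> conditions_1_to_4.
  by apply: is_petit_G_conditions.
pose G0 : petit f -> petit h := @petit_G S sigma tau n k a b alpha.
have suf : conditions_1_to_4 -> is_petit_G tau alpha k G0.
  by move=> [k1 mn [sa sb] E4]; apply: (petit_G_is_petit_G (m := m)).
split; split=> [[G]|].
- exact: nec.
- by move/suf; exists G0.
- case=> GP Gb; have c14 := nec G GP; split=> //.
  by case: c14 => _ _ [_ sb] _; apply/(is_petit_G_bijP _ _ _ _ _ GP).
move=> [c14 c5]; exists G0.
split; first exact: suf.
by case: (c14) => _ _ [_ sb] _; apply/(is_petit_G_bijP _ _ _ _ _ (suf c14)).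
Qed.
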